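(* Consider a sequence of experiments indexed by the sample size $n$ in which treatment is assigned by a Bernoulli design for each $n$, and suppose the regularity conditions (Assumption R in the context) hold with $q\ge 4$. Then, as $n\to\infty$, $$n\,d_{\mathrm{avg}}^{-1}\Big[\widehat{\mathrm{Var}}_{BER}(\hat\tau_{HT})-\mathrm{Var}(\hat\tau_{HT})\Big]-\Big(\frac{\tau_{MSQ}}{d_{\mathrm{avg}}}-B_1-B_2\Big)\ \longrightarrow\ 0\quad\text{in probability},$$ where $$B_1=\frac{1}{n d_{\mathrm{avg}}}\sum_{i=1}^n\sum_{j\ne i}\Big(\breve\xi_{ij}\breve\xi_{ji}+2\breve Y_j\big[\xi_{ij}(1)-\xi_{ij}(0)\big]\Big),$$ $$B_2=\frac{1}{n d_{\mathrm{avg}}}\sum_{i=1}^n\sum_{j\ne i}\sum_{a=0}^1\sum_{b=0}^1(-1)^{a+b}\,\mathrm{Cov}\big(Y_i,Y_j\mid Z_i=a,Z_j=b\big).$$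
   Context: Setting. For each sample size $n$ there are units $U=\{1,\dots,n\}$ and arbitrary potential outcome functions $y_i:\{0,1\}^n\to\mathbb R$, $i\in U$. For $\mathbf z\in\{0,1\}^n$, $\mathbf z_{-i}$ is $\mathbf z$ with its $i$th entry deleted and $\mathbf z_{-ij}$ is $\mathbf z$ with its $i$th and $j$th entries deleted; $y_i(\mathbf z)$ is also written $y_i(z_i;\mathbf z_{-i})$, and $y_{ij}(a,b;\mathbf z_{-ij})$ denotes unit $i$'s potential outcome when units $i$ and $j$ are assigned $a$ and $b$ and the rest $\mathbf z_{-ij}$. An experimental design is the probability distribution of a random vector $\mathbf Z=(Z_1,\dots,Z_n)\in\{0,1\}^n$; it is the only source of randomness. Write $Y_i=y_i(\mathbf Z)$ and $p_i=\Pr(Z_i=1)$. All objects depend on $n$, with no relation assumed between different $n$. Assumption R (regularity conditions). There are constants $k<\infty$, $q\ge 2$, $s\ge 1$ such that for all $n$ and all $i\in U$: $k^{-1}\le \Pr(Z_i=1)\le 1-k^{-1}$; $E[|Y_i|^q]\le k^q$; and $E[|y_i(z;\mathbf Z_{-i})|^s]\le k^s$ for $z\in\{0,1\}$. Bernoulli design: $\Pr(\mathbf Z=\mathbf z)=\prod_{i=1}^n p_i^{z_i}(1-p_i)^{1-z_i}$. Interference. $I_{ij}=1$ if $i=j$ or if $y_j(\mathbf z)\ne y_j(\mathbf z')$ for some $\mathbf z,\mathbf z'\in\{0,1\}^n$ with $\mathbf z_{-i}=\mathbf z'_{-i}$; otherwise $I_{ij}=0$. $d_{ij}=1$ if $I_{\ell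 i}I_{\ell j}=1$ for some $\ell\in U$, else $d_{ij}=0$; $d_{\mathrm{avg}}=n^{-1}\sum_{i,j=1}^n d_{ij}$. Estimators: $\hat\tau_{HT}=\frac1n\sum_i \frac{Z_iY_i}{p_i}-\frac1n\sum_i\frac{(1-Z_i)Y_i}{1-p_i}$ and $\widehat{\mathrm{Var}}_{BER}(\hat\tau_{HT})=\frac1{n^2}\sum_i\frac{Z_iY_i^2}{p_i^2}+\frac1{n^2}\sum_i\frac{(1-Z_i)Y_i^2}{(1-p_i)^2}$. Further notation. $\tau_i(\mathbf z_{-i})=y_i(1;\mathbf z_{-i})-y_i(0;\mathbf z_{-i})$; $\tau_{MSQ}=\frac1n\sum_{i=1}^n\big(E[\tau_i(\mathbf Z_{-i})]\big)^2$; $\xi_{ij}(z)=E[y_{ij}(z,1;\mathbf Z_{-ij})-y_{ij}(z,0;\mathbf Z_{-ij})]$; $\breve\xi_{ij}=(1-p_i)\xi_{ij}(1)+p_i\xi_{ij}(0)$; $\breve Y_i=(1-p_i)E[Y_i\mid Z_i=1]+p_iE[Y_i\mid Z_i=0]$. *)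

(* Defs.v *)
From HB Require Import structures.
From mathcomp Require Import all_boot all_order all_algebra.
From mathcomp Require Import all_classical all_reals all_analysis.

Set Implicit Arguments.
Unset Strict Implicit.
Unset Printing Implicit Defensive.

Import Order.TTheory GRing.Theory Num.Theory.
Import numFieldNormedType.Exports.

Local Open Scope classical_set_scope.
Local Open Scope ring_scope.

(* A point of {0,1}^n; the units are numbered 0, ..., n-1. *)
Definition assignment (n : nat) := {ffun 'I_n -> bool}.

HB.instance Definition _ (n : nat) := Finite.on (assignment n).
HB.instance Definition _ (n : nat) :=
  isPointed.Build (assignment n) [ffun=> false].
HB.instance Definition _ (n : nat) :=
  @isMeasurable.Build default_measure_display (assignment n)
    discrete_measurable discrete_measurable0
    discrete_measurableC discrete_measurableU.

(* A design is the law of the random vector Z. It is a probability measure on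
   {0,1}^n with the discrete sigma-algebra, so the sample point is Z itself:
   a random variable is any function of z, Z_i is z i and Y_i is y i z. *)
Definition design (R : realType) (n : nat) := probability (assignment n) R.

Definition outcomes (R : realType) (n : nat) := 'I_n -> assignment n -> R.

(* [assign z i a] has entry a at i and agrees with z elsewhere, so that
   y i (assign z i a) is y_i(a; z_{-i}) and, for i <> j,
   y i (assign (assign z i a) j b) is y_{ij}(a, b; z_{-ij}). *)
Definition assign (n : nat) (z : assignment n) (i : 'I_n) (a : bool) :
  assignment n := [ffun k => if k == i then a else z k].

Section Probability.
Context {R : realType} {n : nat}.
Implicit Types (P : design R n) (A : set (assignment n))
  (f g : assignment n -> R) (i j : 'I_n) (a b : bool).

(* Applying [fine] loses nothing: every function on the finite space
   {0,1}^n is bounded. *)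
Definition Ex P f : R := fine 'E_P[f].
Definition Var P f : R := fine 'V_P[f].
Definition Cov P f g : R := fine (covariance P f g).

Lemma measurable_assignment A : measurable A. Proof. by []. Qed.

(* The conditional law P( . | A); it is P itself when P(A) = 0. *)
Definition cond P A : design R n :=
  mnormalize (mrestr P (measurable_assignment A)) P.

Definition Zeq i a : set (assignment n) := [set z | z i = a].

Definition prZ P i : R := fine (P (Zeq i true)).

Definition bernoulli_design P : Prop :=
  forall z : assignment n,
    P [set z] =
    (\prod_(i < n) (prZ P i ^+ z i * (1 - prZ P i) ^+ (1 - z i)%N))%:E.

End Probability.

(* k is required to be positive because a (finite) bound k < 0 would make the
   condition on Pr(Z_i = 1) void. *)
Definition regularity (R : realType) (P : forall n, design R n)
    (y : forall n, outcomes R n) (k q s : R) : Prop :=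
  [/\ 0 < k, 2 <= q, 1 <= s &
    forall (n : nat) (i : 'I_n),
      [/\ k^-1 <= prZ (P n) i <= 1 - k^-1,
          Ex (P n) (fun z => `|y n i z| `^ q) <= k `^ q &
          forall a : bool,
            Ex (P n) (fun z => `|y n i (assign z i a)| `^ s) <= k `^ s]].

Section Interference.
Context {R : realType} {n : nat}.
Variable y : outcomes R n.

Definition interferes (i j : 'I_n) : bool :=
  (i == j) ||
  [exists z : assignment n, exists z' : assignment n,
    [forall l : 'I_n, (l != i) ==> (z l == z' l)] && (y j z != y j z')].

Definition dep (i j : 'I_n) : bool :=
  [exists l : 'I_n, interferes l i && interferes l j].

Definition d_avg : R := n%:R^-1 * \sum_(i < n) \sum_(j < n) (dep i j)%:R.

End Interference.

Section Estimators.
Context {R : realType} {n : nat}.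
Variables (P : design R n) (y : outcomes R n).
Implicit Types (z : assignment n) (i j : 'I_n) (a b : bool).

Definition tau_HT z : R :=
  n%:R^-1 * (\sum_(i < n) (z i)%:R * y i z / prZ P i)
  - n%:R^-1 * (\sum_(i < n) (1 - (z i)%:R) * y i z / (1 - prZ P i)).

Definition Var_BER z : R :=
  (n%:R ^+ 2)^-1 * (\sum_(i < n) (z i)%:R * y i z ^+ 2 / prZ P i ^+ 2)
  + (n%:R ^+ 2)^-1 *
    (\sum_(i < n) (1 - (z i)%:R) * y i z ^+ 2 / (1 - prZ P i) ^+ 2).

Definition tau i z : R := y i (assign z i true) - y i (assign z i false).

Definition tau_MSQ : R := n%:R^-1 * \sum_(i < n) Ex P (tau i) ^+ 2.

Definition xi i j a : R :=
  Ex P (fun z => y i (assign (assign z i a) j true)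
               - y i (assign (assign z i a) j false)).

Definition xi_breve i j : R :=
  (1 - prZ P i) * xi i j true + prZ P i * xi i j false.

Definition Y_breve i : R :=
  (1 - prZ P i) * Ex (cond P (Zeq i true)) (y i)
  + prZ P i * Ex (cond P (Zeq i false)) (y i).

Definition B1 : R :=
  (n%:R * d_avg y)^-1 *
  \sum_(i < n) \sum_(j < n | j != i)
    (xi_breve i j * xi_breve j i
     + 2 * Y_breve j * (xi i j true - xi i j false)).

Definition B2 : R :=
  (n%:R * d_avg y)^-1 *
  \sum_(i < n) \sum_(j < n | j != i) \sum_(a : bool) \sum_(b : bool)
    (-1) ^+ (a + b)%N * Cov (cond P (Zeq i a `&` Zeq j b)) (y i) (y j).

End Estimators.

(* Convergence in probability to c; each X_n lives on its own space. *)
Definition cvg_in_probability (R : realType) (P : forall n, design R n)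
    (X : forall n, assignment n -> R) (c : R) : Prop :=
  forall eps : R, 0 < eps ->
    P n [set z | eps < `|X n z - c|] @[n --> \oo] --> 0%E.

(* Main.v *)
(** The centering is exact: for every n > 0,
    n (E[Var_BER] - Var(tau_HT)) = tau_MSQ - d_avg (B1 + B2).
    Indeed, writing tau_HT = n^-1 sum_i T_i with T_i the inverse-probability
    weighted outcome, E[Var_BER] = n^-2 sum_i E[T_i^2], so the difference is
    n^-2 (sum_i E[T_i]^2 - sum_(i <> j) Cov(T_i, T_j)), with E[T_i] = E[tau_i],
    and each covariance is a mixed second difference over (Z_i, Z_j) that the
    discrete product rule expands into the summands of B1 and B2. What remains
    is the fluctuation of Var_BER about its mean: T_i^2 and T_j^2 are independent
    unless d_ij = 1, and their covariance is bounded by fourth moments, hence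
    Var(n Var_BER / d_avg) <= C / (n d_avg) <= C / n and Chebyshev applies. *)
Require Import Defs.
From mathcomp Require Import all_boot all_order all_algebra.
From mathcomp Require Import all_classical all_reals all_analysis.
From mathcomp Require Import ring lra.

Import Order.TTheory GRing.Theory Num.Theory.
Import numFieldNormedType.Exports.

Local Open Scope classical_set_scope.
Local Open Scope ring_scope.

(** * Expectation, covariance and conditioning on a finite space *)

Section FiniteExpectation.
Context {R : realType} {n : nat}.
Implicit Types (P : design R n) (f g : assignment n -> R) (i j : 'I_n).

Definition pmf P z : R := fine (P [set z]).

Lemma pmfE P z : P [set z] = (pmf P z)%:E.
Proof. by rewrite fineK// fin_num_measure. Qed.

Lemma pmf_ge0 P z : 0 <= pmf P z.
Proof. exact: fine_ge0. Qed.

(** Decomposing [f] over indicators of singletons turns the integral into a finite sum, so that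
    linearity and monotonicity of [Ex] become facts about sums. *)
Lemma expectationE P f : 'E_P[f]%E = (\sum_z pmf P z * f z)%:E.
Proof.
rewrite unlock.
have intA (A : set (assignment n)) : P.-integrable setT (EFin \o \1_A).
  by apply: integrable_indic.
under eq_integral => w _.
  have -> : (f w)%:E = (\sum_z (f z)%:E * (\1_[set z] w)%:E)%E.
    rewrite (bigD1 w)//= indicE mem_set// mule1 big1 ?adde0// => z zw.
    by rewrite indicE memNset ?mule0//= => wz; rewrite wz eqxx in zw.
  over.
rewrite integral_sum//; last by move=> z; apply: (integrableZl measurableT _ (intA _)).
rewrite -sumEFin; apply: eq_bigr => z _.
rewrite (integralZl measurableT (intA _)) integral_indic// setIT.
by rewrite EFinM -pmfE muleC.
Qed.

Lemma ExE P f : Ex P f = \sum_z pmf P z * f z.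
Proof. by rewrite /Ex expectationE. Qed.

Lemma fine_measureE P (A : set (assignment n)) : fine (P A) = Ex P \1_A.
Proof. by rewrite /Ex expectation_indic. Qed.

Lemma Ex_ext P f g : f =1 g -> Ex P f = Ex P g.
Proof. by move=> /funext ->. Qed.

Lemma Ex_cst P c : Ex P (fun=> c) = c.
Proof. by rewrite /Ex (expectation_cst P c). Qed.

Lemma ExD P f g : Ex P (fun z => f z + g z) = Ex P f + Ex P g.
Proof.
by rewrite !ExE -big_split; apply: eq_bigr => z _; rewrite mulrDr.
Qed.

Lemma ExZ P c f : Ex P (fun z => c * f z) = c * Ex P f.
Proof.
by rewrite !ExE mulr_sumr; apply: eq_bigr => z _; rewrite mulrCA.
Qed.

Lemma ExB P f g : Ex P (fun z => f z - g z) = Ex P f - Ex P g.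
Proof.
by rewrite !ExE -sumrB; apply: eq_bigr => z _; rewrite mulrBr.
Qed.

Lemma Ex_sum P (I : Type) (r : seq I) (p : pred I) (F : I -> assignment n -> R) :
  Ex P (fun z => \sum_(i <- r | p i) F i z) = \sum_(i <- r | p i) Ex P (F i).
Proof.
rewrite ExE; under eq_bigr do rewrite mulr_sumr.
by rewrite exchange_big; apply: eq_bigr => i _; rewrite ExE.
Qed.

Lemma Ex_le P f g : (forall z, f z <= g z) -> Ex P f <= Ex P g.
Proof.
by move=> fg; rewrite !ExE ler_sum// => z _; rewrite ler_wpM2l ?pmf_ge0.
Qed.

Lemma Ex_ge0 P f : (forall z, 0 <= f z) -> 0 <= Ex P f.
Proof. by move=> f0; rewrite -(Ex_cst P 0) Ex_le. Qed.

Lemma CovE P f g : Cov P f g = Ex P (fun z => f z * g z) - Ex P f * Ex P g.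
Proof.
have -> : Cov P f g = Ex P (fun z => (f z - Ex P f) * (g z - Ex P g)).
  by rewrite /Cov unlock.
rewrite (@Ex_ext _ _ (fun z => f z * g z - Ex P g * f z
  - (Ex P f * g z - Ex P f * Ex P g))); last by move=> z; ring.
by rewrite !ExB !ExZ Ex_cst; ring.
Qed.

Lemma CovZ P c f g :
  Cov P (fun z => c * f z) (fun z => c * g z) = c ^+ 2 * Cov P f g.
Proof.
rewrite !CovE !ExZ (@Ex_ext _ _ (fun z => c ^+ 2 * (f z * g z))).
  by rewrite ExZ; ring.
by move=> z; ring.
Qed.

Lemma Cov_sum P (I : Type) (r : seq I) (F : I -> assignment n -> R) :
  Cov P (fun z => \sum_(i <- r) F i z) (fun z => \sum_(i <- r) F i z)
  = \sum_(i <- r) \sum_(j <- r) Cov P (F i) (F j).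
Proof.
rewrite CovE !Ex_sum mulr_suml (@Ex_ext _ _
  (fun z => \sum_(i <- r) \sum_(j <- r) F i z * F j z)); last first.
  by move=> z; rewrite mulr_suml; apply: eq_bigr => i _; rewrite mulr_sumr.
rewrite Ex_sum -sumrB; apply: eq_bigr => i _.
by rewrite Ex_sum mulr_sumr -sumrB; apply: eq_bigr => j _; rewrite CovE.
Qed.

Lemma Var_centered P f : Ex P (fun z => (f z - Ex P f) ^+ 2) = Var P f.
Proof.
rewrite -[RHS]/(Cov P f f) CovE (@Ex_ext _ _ (fun z => f z * f z -
   (2 * Ex P f * f z - Ex P f * Ex P f))); last by move=> z; ring.
by rewrite !ExB !ExZ Ex_cst; ring.
Qed.

(** The indicator of the event is pointwise at most [f z ^+ 2 / eps ^+ 2]. *)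
Lemma chebyshev_design P f eps : 0 < eps ->
  fine (P [set z | eps < `|f z|]) <= Ex P (fun z => f z ^+ 2) / eps ^+ 2.
Proof.
move=> e0; rewrite fine_measureE mulrC -ExZ; apply: Ex_le => z.
rewrite mulrC indicE; case: (boolP (z \in _)) => /=; last first.
  by move=> _; rewrite divr_ge0 ?sqr_ge0.
rewrite inE /= => ef; rewrite ler_pdivlMr ?exprn_gt0// mul1r -(real_normK (num_real (f z))).
by rewrite ler_sqr ?nnegrE// ltW.
Qed.

Lemma Ex_cond P (A : set (assignment n)) f : 0 < fine (P A) ->
  Ex (cond P A) f = Ex P (fun z => \1_A z * f z) / fine (P A).
Proof.
move=> A0.
have E (B : set (assignment n)) :
    cond P A B = (P (B `&` A) * (fine (P A))^-1%:E)%E.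
  rewrite /cond /= /mnormalize /= /mrestr setTI.
  (* [mnormalize] falls back to [P] when the mass is zero or infinite; [fine] sends both to 0,
     against [A0]. *)
  case: ifPn => // /orP[] /eqP PA; by rewrite PA ltxx in A0.
rewrite !ExE mulr_suml; apply: eq_bigr => z _.
rewrite /pmf E indicE; case: (boolP (z \in A)) => /= zA.
  rewrite (_ : [set z] `&` A = [set z]); last first.
    by apply/setIidl => w ->; rewrite inE in zA.
  by rewrite pmfE -EFinM /= mul1r mulrAC.
rewrite (_ : [set z] `&` A = set0).
  by rewrite measure0 mul0e/= !mul0r mulr0 mul0r.
by apply/seteqP; split => // w [->] Az; rewrite notin_setE in zA.
Qed.

End FiniteExpectation.

(** * Independence and conditioning under a Bernoulli design *)

Section Bernoulli.
Context {R : realType} {n : nat}.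
Implicit Types (f g : assignment n -> R) (i j : 'I_n) (S T : {set 'I_n}).

Definition glue S (z z' : assignment n) : assignment n :=
  [ffun i => if i \in S then z i else z' i].

Definition depends_on S f :=
  forall z z' : assignment n, {in S, z =1 z'} -> f z = f z'.

Lemma depends_on_assign i a f :
  depends_on (~: [set i]) (fun z => f (assign z i a)).
Proof.
move=> z z' zz'; congr f; apply/ffunP => l; rewrite !ffunE.
by case: eqP => // /eqP li; rewrite zz'// !inE.
Qed.

Lemma depends_on_coord i (F : bool -> R) : depends_on [set i] (fun z => F (z i)).
Proof. by move=> z z' -> //; rewrite inE. Qed.

Lemma assignC (z : assignment n) i j a b : i != j ->
  assign (assign z i a) j b = assign (assign z j b) i a.
Proof.
by move=> ij; apply/ffunP => l; rewrite !ffunE; case: eqP => // ->;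
  rewrite eq_sym (negbTE ij).
Qed.

(** Walk from [z] to [z'] one coordinate at a time: a move outside [S] preserves [f] by hypothesis,
    and a move inside [S] changes nothing because [z] and [z'] agree there. *)
Lemma depends_on_invariant S f :
  (forall i z b, i \notin S -> f (assign z i b) = f z) -> depends_on S f.
Proof.
move=> fS z z' zz'.
pose walk (s : seq 'I_n) := foldr (fun i w => assign w i (z' i)) z s.
have walkE s l : walk s l = if l \in s then z' l else z l.
  elim: s => //= i s IH; rewrite ffunE inE IH.
  by case: eqP => // ->.
have fwalk s : f (walk s) = f z.
  elim: s => //= i s <-; case: (boolP (i \in S)) => iS; last exact: fS.
  congr f; apply/ffunP => l; rewrite ffunE; case: eqP => // ->.
  by rewrite walkE (zz' i iS) if_same.
rewrite -(fwalk (enum 'I_n)); congr f; apply/ffunP => l.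
by rewrite walkE mem_enum.
Qed.

Variable P : design R n.

Definition marginal i a : R := if a then prZ P i else 1 - prZ P i.

Lemma marginalE i a : marginal i a = Ex P (fun z => (z i == a)%:R).
Proof.
have E1 : prZ P i = Ex P (fun z => (z i)%:R).
  rewrite /prZ fine_measureE; apply: Ex_ext => z; rewrite indicE.
  by congr (nat_of_bool _)%:R; apply/idP/idP; rewrite inE.
case: a; rewrite /marginal E1; first by apply: Ex_ext => z; rewrite eqb_id.
rewrite -{1}(Ex_cst P 1) -ExB; apply: Ex_ext => z.
by case: (z i); rewrite /= ?subrr ?subr0.
Qed.

Hypothesis bernP : bernoulli_design P.

Lemma pmf_bernoulli z : pmf P z = \prod_i marginal i (z i).
Proof.
rewrite /pmf bernP /=; apply: eq_bigr => i _.
by case: (z i) => /=; rewrite ?subnn ?subn0 ?expr0 ?expr1 ?mulr1 ?mul1r.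
Qed.

(** In the product form, gluing only swaps the two factors of each coordinate outside [S]. *)
Lemma pmf_glue S z z' :
  pmf P (glue S z z') * pmf P (glue S z' z) = pmf P z * pmf P z'.
Proof.
rewrite !pmf_bernoulli -!big_split; apply: eq_bigr => i _ /=.
by rewrite !ffunE; case: ifP => // _; rewrite mulrC.
Qed.

(* Exchanging the coordinates outside S between two independent copies of Z
   is an involution preserving their joint law. *)
Lemma Ex_glue S f : Ex P f = Ex P (fun z => Ex P (fun z' => f (glue S z z'))).
Proof.
rewrite (@Ex_ext _ _ P f (fun z => Ex P (fun=> f z))); last first.
  by move=> z; rewrite Ex_cst.
rewrite !ExE.
under eq_bigr do rewrite ExE mulr_sumr.
under [RHS]eq_bigr do rewrite ExE mulr_sumr.
rewrite !pair_bigA /=.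
pose h (u : assignment n * assignment n) := (glue S u.1 u.2, glue S u.2 u.1).
have hK : involutive h.
  move=> [z z']; rewrite /h /=; congr (_, _); apply/ffunP => i;
  by rewrite !ffunE; case: (i \in S).
rewrite (reindex_inj (inv_inj hK)) /=; apply: eq_bigr => -[z z'] _ /=.
by rewrite !mulrA pmf_glue.
Qed.

(** On the glued point [glue S z z'], [f] sees only [z] and [g] only [z'], so the double expectation
    of [Ex_glue] factors. *)
Lemma Ex_indep S T f g : {in S, forall i, i \notin T} -> depends_on S f -> depends_on T g ->
  Ex P (fun z => f z * g z) = Ex P f * Ex P g.
Proof.
move=> ST fS gT; rewrite (Ex_glue S) mulrC -ExZ; apply: Ex_ext => z.
rewrite mulrC -ExZ; apply: Ex_ext => z'; congr (_ * _).
  by apply: fS => i iS; rewrite ffunE iS.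
apply: gT => i iT; rewrite ffunE ifN//; apply: contraL iT; exact: ST.
Qed.

(** Split on the value of [z i]: the event [z i == a] involves entry [i] alone and
    [f (assign z i a)] only the other entries, so [Ex_indep] separates them. *)
Lemma Ex_coord i (F : bool -> R) f :
  Ex P (fun z => F (z i) * f z)
  = \sum_(a : bool) F a * marginal i a * Ex P (fun z => f (assign z i a)).
Proof.
rewrite (@Ex_ext _ _ _ _ (fun z => \sum_(a : bool)
   F a * ((z i == a)%:R * f (assign z i a)))); last first.
  move=> z; rewrite (bigD1 (z i))//= eqxx mul1r big1 ?addr0.
    by congr (_ * f _); apply/ffunP => l; rewrite ffunE; case: eqP => // ->.
  by move=> b /negbTE; rewrite eq_sym => ->; rewrite mul0r mulr0.
rewrite Ex_sum; apply: eq_bigr => a _; rewrite ExZ -mulrA marginalE.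
congr (_ * _); apply: (@Ex_indep [set i] (~: [set i])).
- by move=> j; rewrite !inE negbK.
- exact: (@depends_on_coord i (fun b => (b == a)%:R)).
- exact: depends_on_assign.
Qed.

Lemma Ex_assign i f :
  Ex P f = \sum_(a : bool) marginal i a * Ex P (fun z => f (assign z i a)).
Proof.
rewrite -(@Ex_ext _ _ _ (fun z => 1 * f z)); last by move=> z; rewrite mul1r.
rewrite (@Ex_coord i (fun=> 1) f).
by under eq_bigr do rewrite mul1r.
Qed.

Lemma Ex_coord_eq i a f : Ex P (fun z => (z i == a)%:R * f z)
  = marginal i a * Ex P (fun z => f (assign z i a)).
Proof.
rewrite (@Ex_coord i (fun b => (b == a)%:R)) (bigD1 a)//= eqxx mul1r big1 ?addr0//.
by move=> b /negbTE ->; rewrite !mul0r.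
Qed.

Hypothesis marginal_gt0 : forall i a, 0 < marginal i a.

Lemma indic_Zeq i a z : \1_(Zeq i a) z = (z i == a)%:R :> R.
Proof.
rewrite indicE; congr (nat_of_bool _)%:R.
by apply/idP/eqP; rewrite inE.
Qed.

(** By independence the other entries keep their law given [Z_i = a], so conditioning amounts to
    overwriting entry [i]. *)
Lemma Ex_cond1 i a f :
  Ex (cond P (Zeq i a)) f = Ex P (fun z => f (assign z i a)).
Proof.
have PA : fine (P (Zeq i a)) = marginal i a.
  by rewrite fine_measureE marginalE; apply: Ex_ext => z; exact: indic_Zeq.
rewrite Ex_cond PA// (@Ex_ext _ _ _ _ (fun z => (z i == a)%:R * f z)).
  by rewrite Ex_coord_eq mulrAC mulfV ?mul1r// gt_eqF.
by move=> z; rewrite indic_Zeq.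
Qed.

Lemma Ex_cond2 i j a b f : i != j -> Ex (cond P (Zeq i a `&` Zeq j b)) f
  = Ex P (fun z => f (assign (assign z i a) j b)).
Proof.
move=> ij.
have E g : Ex P (fun z => \1_(Zeq i a `&` Zeq j b) z * g z) =
    marginal i a * marginal j b * Ex P (fun z => g (assign (assign z i a) j b)).
  rewrite (@Ex_ext _ _ _ _ (fun z => (z i == a)%:R * ((z j == b)%:R * g z))).
    rewrite Ex_coord_eq -mulrA; congr (_ * _).
    under [in RHS]Ex_ext do rewrite assignC//.
    rewrite -(@Ex_coord_eq j b (fun z => g (assign z i a))).
    apply: Ex_ext => z.
    by rewrite ffunE [j == i]eq_sym (negbTE ij).
  by move=> z; rewrite indicI /= !indic_Zeq mulrA.
have PA : fine (P (Zeq i a `&` Zeq j b)) = marginal i a * marginal j b.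
  (* The constant 1 in [E] gives the probability of the conditioning event. *)
  have := E (fun=> 1); rewrite Ex_cst mulr1 => <-.
  by rewrite fine_measureE; apply: Ex_ext => z; rewrite mulr1.
have m0 : 0 < marginal i a * marginal j b by rewrite mulr_gt0.
by rewrite Ex_cond PA// E mulrAC mulfV ?mul1r// gt_eqF.
Qed.

(** The Horvitz-Thompson weight [Z_i / p_i - (1 - Z_i) / (1 - p_i)] at [Z_i = a], merging both arms
    of the estimator into one factor. *)
Definition ht_weight i a : R :=
  if a then (marginal i a)^-1 else - (marginal i a)^-1.

(** The weight cancels the probability of each arm up to sign; in expectation it acts as the
    difference operator in coordinate [i]. *)
Lemma Ex_ht_weight i f : Ex P (fun z => ht_weight i (z i) * f z)
  = Ex P (fun z => f (assign z i true)) - Ex P (fun z => f (assign z i false)).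
Proof.
by rewrite Ex_coord big_bool /ht_weight mulNr !mulVf ?gt_eqF// mul1r mulN1r.
Qed.

End Bernoulli.

(** * Exact bias of the variance estimator *)

Section Bias.
Context {R : realType} {n : nat}.
Variables (P : design R n) (y : outcomes R n).
Hypotheses (bernP : bernoulli_design P)
  (marginal_gt0 : forall i a, 0 < marginal P i a).
Implicit Types i j : 'I_n.

Definition ht_term i (z : assignment n) : R := ht_weight P i (z i) * y i z.

Lemma tau_HTE : tau_HT P y = fun z => n%:R^-1 * \sum_i ht_term i z.
Proof.
apply/funext => z; rewrite /tau_HT -mulrBr -sumrB; congr (_ * _).
apply: eq_bigr => i _; rewrite /ht_term /ht_weight /marginal.
by case: (z i) => /=; ring.
Qed.

(** Squaring erases the sign of the weight and creates no cross term, as each unit is in exactly one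
    arm. *)
Lemma Var_BERE : Var_BER P y = fun z => (n%:R ^+ 2)^-1 * \sum_i ht_term i z ^+ 2.
Proof.
apply/funext => z; rewrite /Var_BER -mulrDr -big_split; congr (_ * _).
apply: eq_bigr => i _; rewrite /ht_term /ht_weight /marginal.
by rewrite -!exprVn; case: (z i) => /=; ring.
Qed.

Lemma Ex_ht_term i : Ex P (ht_term i) = Ex P (tau y i).
Proof. by rewrite Ex_ht_weight// -ExB. Qed.

(** Apply [Ex_ht_weight] at [i] and then at [j]; since [i != j], overwriting entry [i] leaves the
    weight of [j] intact. *)
Lemma Ex_ht_term2 i j : i != j ->
  Ex P (fun z => ht_term i z * ht_term j z)
  = \sum_(a : bool) \sum_(b : bool) (-1) ^+ (a + b)%N *
      Ex P (fun z => y i (assign (assign z i a) j b)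
                   * y j (assign (assign z i a) j b)).
Proof.
move=> ij.
rewrite (@Ex_ext _ _ _ _ (fun z => ht_weight P i (z i) *
   (ht_weight P j (z j) * (y i z * y j z)))); last first.
  by move=> z; rewrite /ht_term; ring.
rewrite Ex_ht_weight//.
have E a : Ex P (fun z => ht_weight P j (assign z i a j)
      * (y i (assign z i a) * y j (assign z i a)))
    = Ex P (fun z => y i (assign (assign z i a) j true)
                   * y j (assign (assign z i a) j true))
    - Ex P (fun z => y i (assign (assign z i a) j false)
                   * y j (assign (assign z i a) j false)).
  rewrite (@Ex_ext _ _ _ _ (fun z => ht_weight P j (z j)
      * (y i (assign z i a) * y j (assign z i a)))); last first.
    by move=> z; rewrite ffunE [j == i]eq_sym (negbTE ij).
  rewrite Ex_ht_weight//.
  by congr (_ - _); apply: Ex_ext => z;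
    rewrite [assign (assign z j _) i a]assignC// eq_sym.
by rewrite !E !big_bool /=; ring.
Qed.

(* With u a b and v a b the means of Y_i and Y_j given (Z_i, Z_j) = (a, b),
   this is the mixed second difference of the product u v, expanded by the
   discrete product rule with the averages over i and j weighted by p_i, p_j. *)
Lemma Cov_ht_term i j : i != j ->
  Cov P (ht_term i) (ht_term j)
  = \sum_(a : bool) \sum_(b : bool)
      (-1) ^+ (a + b)%N * Cov (cond P (Zeq i a `&` Zeq j b)) (y i) (y j)
    + xi_breve P y i j * xi_breve P y j i
    + Y_breve P y j * (xi P y i j true - xi P y i j false)
    + Y_breve P y i * (xi P y j i true - xi P y j i false).
Proof.
move=> ij; have ji : j != i by rewrite eq_sym.
pose u a b := Ex P (fun z => y i (assign (assign z i a) j b)).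
pose v a b := Ex P (fun z => y j (assign (assign z i a) j b)).
have uE a : Ex P (fun z => y i (assign z i a))
    = prZ P j * u a true + (1 - prZ P j) * u a false.
  rewrite (Ex_assign P bernP j) big_bool /=.
  by congr (_ * _ + _ * _); apply: Ex_ext => z; rewrite assignC.
have vE b : Ex P (fun z => y j (assign z j b))
    = prZ P i * v true b + (1 - prZ P i) * v false b.
  by rewrite (Ex_assign P bernP i) big_bool.
have xijE a : xi P y i j a = u a true - u a false by rewrite /xi ExB.
have xjiE b : xi P y j i b = v true b - v false b.
  by rewrite /xi ExB; congr (_ - _); apply: Ex_ext => z; rewrite assignC.
have covE a b : Cov (cond P (Zeq i a `&` Zeq j b)) (y i) (y j)
    = Ex P (fun z => y i (assign (assign z i a) j b)
                   * y j (assign (assign z i a) j b)) - u a b * v a b.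
  by rewrite CovE !Ex_cond2.
rewrite CovE Ex_ht_term2// !Ex_ht_term /tau !ExB !uE !vE.
rewrite /Y_breve /xi_breve !Ex_cond1// !uE !vE !xijE !xjiE.
rewrite !big_bool /= !covE /=.
by ring.
Qed.

(** The diagonal pairs alone contribute [n], since every unit interferes with itself. *)
Lemma d_avg_ge1 : (0 < n)%N -> 1 <= d_avg y.
Proof.
move=> n0; rewrite /d_avg mulrC ler_pdivlMr ?ltr0n// mul1r.
rewrite -[X in X%:R]card_ord -sumr_const; apply: ler_sum => i _.
rewrite (bigD1 i)//= (_ : dep y i i) ?lerDl ?sumr_ge0//.
by apply/existsP; exists i; rewrite /interferes eqxx.
Qed.

Lemma bias_identity : (0 < n)%N ->
  n%:R * (d_avg y)^-1 * (Ex P (Var_BER P y) - Var P (tau_HT P y))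
  = tau_MSQ P y / d_avg y - B1 P y - B2 P y.
Proof.
move=> n0; have d0 : d_avg y != 0.
  by rewrite gt_eqF// (lt_le_trans ltr01)// d_avg_ge1.
have nn0 : n%:R != 0 :> R by rewrite pnatr_eq0 -lt0n.
pose C i j := \sum_(a : bool) \sum_(b : bool)
  (-1) ^+ (a + b)%N * Cov (cond P (Zeq i a `&` Zeq j b)) (y i) (y j).
pose D i j := Y_breve P y j * (xi P y i j true - xi P y i j false).
(* [Cov_ht_term] yields such a term for each order of the pair; swapping indices identifies their
   sums, whence the factor 2 in [B1]. *)
have DD : \sum_i \sum_(j | j != i) D j i = \sum_i \sum_(j | j != i) D i j.
  rewrite (exchange_big_dep xpredT)//=; apply: eq_bigr => i _.
  by apply: eq_bigl => j; rewrite eq_sym.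
have VE : Var P (tau_HT P y) = n%:R^-1 ^+ 2 * (\sum_i \sum_(j | j != i)
     Cov P (ht_term i) (ht_term j) + \sum_i Cov P (ht_term i) (ht_term i)).
  rewrite -[LHS]/(Cov P (tau_HT P y) (tau_HT P y)) tau_HTE CovZ Cov_sum.
  by rewrite -big_split; congr (_ * _); apply: eq_bigr => i _; rewrite (bigD1 i)//= addrC.
have SE : \sum_i \sum_(j | j != i) Cov P (ht_term i) (ht_term j)
    = \sum_i \sum_(j | j != i) C i j
      + \sum_i \sum_(j | j != i) (xi_breve P y i j * xi_breve P y j i
          + 2 * Y_breve P y j * (xi P y i j true - xi P y i j false)).
  transitivity (\sum_i \sum_(j | j != i)
     (C i j + xi_breve P y i j * xi_breve P y j i + D i j)
      + \sum_i \sum_(j | j != i) D j i).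
    rewrite -big_split; apply: eq_bigr => i _; rewrite -big_split.
    by apply: eq_bigr => j ji; rewrite Cov_ht_term// eq_sym.
  rewrite DD -!big_split; apply: eq_bigr => i _; rewrite -!big_split.
  by apply: eq_bigr => j _ /=; rewrite /D; ring.
(* The second moments on the diagonal will cancel the mean of [Var_BER], leaving the squared means
   as [tau_MSQ]. *)
have TE : \sum_i Cov P (ht_term i) (ht_term i)
    = Ex P (fun z => \sum_i ht_term i z ^+ 2) - n%:R * tau_MSQ P y.
  rewrite /tau_MSQ mulrA mulfV// mul1r Ex_sum -sumrB; apply: eq_bigr => i _.
  by rewrite CovE !Ex_ht_term expr2; congr (_ - _); apply: Ex_ext => z; rewrite expr2.
rewrite VE SE TE Var_BERE ExZ /B1 /B2 -/(C _ _).
by field; rewrite nn0 d0.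
Qed.

End Bias.

(** * Interference sets and the variance of [Var_BER] *)

Section Concentration.
Context {R : realType} {n : nat}.
Variables (P : design R n) (y : outcomes R n).
Hypothesis bernP : bernoulli_design P.
Implicit Types i j : 'I_n.

(** Interference tests a change of one entry; [depends_on_invariant] extends this to changing all
    non-interfering entries at once. *)
Lemma outcome_depends_on i : depends_on [set l | interferes y l i] (y i).
Proof.
apply: depends_on_invariant => l z b; rewrite inE negb_or => /andP[_].
move=> /existsPn/(_ (assign z l b))/existsPn/(_ z); rewrite negb_and negbK.
case/orP => [/negP[]|/eqP//].
by apply/forallP => m; apply/implyP => /negbTE ml; rewrite ffunE ml.
Qed.

Lemma ht_term_depends_on i :
  depends_on [set l | interferes y l i] (ht_term P y i).
Proof.
move=> z z' zz'; rewrite /ht_term (outcome_depends_on _ _ _ zz') zz'//.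
by rewrite inE /interferes eqxx.
Qed.

(** [~~ dep y i j] means that the interference sets of [i] and [j] are disjoint, so [Ex_indep]
    applies. *)
Lemma Cov_sqr_ht_term_eq0 i j : ~~ dep y i j ->
  Cov P (fun z => ht_term P y i z ^+ 2) (fun z => ht_term P y j z ^+ 2) = 0.
Proof.
move=> /existsPn ij; rewrite CovE.
rewrite (@Ex_indep _ _ _ bernP [set l | interferes y l i]
  [set l | interferes y l j]) ?subrr//.
- by move=> l; rewrite !inE => li; have := ij l; rewrite li.
- by move=> z z' zz'; rewrite (ht_term_depends_on _ _ _ zz').
- by move=> z z' zz'; rewrite (ht_term_depends_on _ _ _ zz').
Qed.

Variables (k q : R).
Hypotheses (k_gt0 : 0 < k) (q_ge4 : 4 <= q)
  (positivity : forall i, k^-1 <= prZ P i <= 1 - k^-1)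
  (moment : forall i, Ex P (fun z => `|y i z| `^ q) <= k `^ q).

Lemma marginal_ge i a : k^-1 <= marginal P i a.
Proof. by have /andP[? ?] := positivity i; case: a => //=; rewrite /marginal; lra. Qed.

(** The summand 1 covers [|x| <= 1]; beyond that, [q >= 4] makes the [q]-th power dominate. *)
Lemma expr4_le_powR (x : R) : x ^+ 4 <= 1 + `|x| `^ q.
Proof.
have -> : x ^+ 4 = `|x| ^+ 4 by rewrite -normrX ger0_norm// exprn_even_ge0.
have [x1|/ltW x1] := leP `|x| 1.
  by rewrite (@le_trans _ _ 1) ?lerDl ?powR_ge0// exprn_ile1.
by rewrite -powR_mulrn// ler_wpDl// ler_powR.
Qed.

Lemma sqr_ht_weight_le i a : ht_weight P i a ^+ 2 <= k ^+ 2.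
Proof.
have m0 : 0 < marginal P i a.
  by rewrite (lt_le_trans _ (marginal_ge i a))// invr_gt0.
have -> : ht_weight P i a ^+ 2 = (marginal P i a)^-1 ^+ 2.
  by rewrite /ht_weight; case: a m0 => //; rewrite sqrrN.
rewrite ler_sqr ?nnegrE ?invr_ge0 ?(ltW m0) ?(ltW k_gt0)//.
by rewrite invf_ple ?posrE// marginal_ge.
Qed.

Lemma Ex_ht_term4_le i :
  Ex P (fun z => ht_term P y i z ^+ 4) <= k ^+ 4 * (1 + k `^ q).
Proof.
apply: (@le_trans _ _ (Ex P (fun z => k ^+ 4 * (1 + `|y i z| `^ q)))).
  apply: Ex_le => z; rewrite exprMn ler_pM ?expr4_le_powR//.
  - by rewrite exprn_even_ge0.
  - by rewrite exprn_even_ge0.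
  by rewrite -[4%N]/(2 * 2)%N !exprM ler_sqr ?nnegrE ?sqr_ge0// sqr_ht_weight_le.
by rewrite ExZ ExD Ex_cst ler_pM2l ?exprn_gt0// lerD2l.
Qed.

Lemma Cov_sqr_ht_term_le i j :
  Cov P (fun z => ht_term P y i z ^+ 2) (fun z => ht_term P y j z ^+ 2)
  <= (dep y i j)%:R * (k ^+ 4 * (1 + k `^ q)).
Proof.
have [_|/Cov_sqr_ht_term_eq0 ->] := boolP (dep y i j); last by rewrite mul0r.
rewrite mul1r CovE.
(* The product of means is nonnegative and is dropped; the inequality [2 a^2 b^2 <= a^4 + b^4] then
   brings in fourth moments. *)
apply: (@le_trans _ _ (Ex P (fun z => ht_term P y i z ^+ 2 * ht_term P y j z ^+ 2))).
  by rewrite gerBl mulr_ge0 ?Ex_ge0// => z; rewrite sqr_ge0.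
apply: (@le_trans _ _ (Ex P (fun z =>
    2^-1 * (ht_term P y i z ^+ 4 + ht_term P y j z ^+ 4)))).
  apply: Ex_le => z; set a := ht_term _ _ _ _; set b := ht_term _ _ _ _.
  by have := sqr_ge0 (a ^+ 2 - b ^+ 2); nra.
rewrite ExZ ExD; have := Ex_ht_term4_le i; have := Ex_ht_term4_le j; lra.
Qed.

Lemma scaled_Var_BER_le : (0 < n)%N ->
  (n%:R * (d_avg y)^-1) ^+ 2 * Var P (Var_BER P y)
  <= k ^+ 4 * (1 + k `^ q) / n%:R.
Proof.
move=> n0; have d1 := d_avg_ge1 y n0.
have d0 : 0 < d_avg y by apply: lt_le_trans d1.
have nn0 : 0 < n%:R :> R by rewrite ltr0n.
set K := k ^+ 4 * _.
have K0 : 0 <= K by rewrite mulr_ge0 ?exprn_ge0 ?ltW// ltr_wpDr ?powR_ge0.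
(* [n * d_avg] counts the ordered pairs with [dep], and each contributes at most [K]. *)
have S : \sum_i \sum_j Cov P (fun z => ht_term P y i z ^+ 2)
    (fun z => ht_term P y j z ^+ 2) <= n%:R * d_avg y * K.
  rewrite /d_avg mulVKf ?gt_eqF// mulr_suml; apply: ler_sum => i _.
  by rewrite mulr_suml; apply: ler_sum => j _; exact: Cov_sqr_ht_term_le.
rewrite -[Var P _]/(Cov P (Var_BER P y) (Var_BER P y)) Var_BERE CovZ Cov_sum.
apply: (@le_trans _ _ ((n%:R * (d_avg y)^-1) ^+ 2
    * ((n%:R ^+ 2)^-1 ^+ 2 * (n%:R * d_avg y * K)))).
  by rewrite !ler_wpM2l ?sqr_ge0.
have -> : (n%:R * (d_avg y)^-1) ^+ 2
    * ((n%:R ^+ 2)^-1 ^+ 2 * (n%:R * d_avg y * K)) = K / n%:R / d_avg y.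
  by field; rewrite !gt_eqF.
(* The spare factor [(d_avg y)^-1] is at most 1. *)
by rewrite ler_pdivrMr// ler_peMr// divr_ge0.
Qed.

End Concentration.

(** * Convergence in probability *)

Theorem proposition7 (R : realType) (P : forall n : nat, design R n)
    (y : forall n : nat, outcomes R n) (k q s : R)
    (bernoulliP : forall n : nat, bernoulli_design (P n))
    (regP : regularity P y k q s) (q_ge4 : 4 <= q) :
  cvg_in_probability P
    (fun (n : nat) (z : assignment n) =>
       n%:R * (d_avg (y n))^-1 *
         (Var_BER (P n) (y n) z - Var (P n) (tau_HT (P n) (y n)))
       - (tau_MSQ (P n) (y n) / d_avg (y n)
          - B1 (P n) (y n) - B2 (P n) (y n)))
    0.
Proof.
case: regP => k0 _ _ reg eps eps0.
have pos n i : k^-1 <= prZ (P n) i <= 1 - k^-1 by case: (reg n i).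
have mom n i : Ex (P n) (fun z => `|y n i z| `^ q) <= k `^ q by case: (reg n i).
have m0 n i a : 0 < marginal (P n) i a.
  by rewrite (lt_le_trans _ (marginal_ge _ _ (pos n) i a))// invr_gt0.
(* The shift to [n.+1] supplies the positive sample size that the bias identity and the variance
   bound require, and matches [harmonic n], the inverse of [n.+1]. *)
rewrite -cvg_shiftS /=.
pose K := k ^+ 4 * (1 + k `^ q) / eps ^+ 2.
set A := fun n => _; have AE n : A n = (fine (A n))%:E by rewrite fineK// fin_num_measure.
have A0 n : 0 <= fine (A n) by rewrite fine_ge0// measure_ge0.
rewrite (_ : A = EFin \o (fine \o A)); last by apply/funext => n; exact: AE.
apply: cvg_EFin; first by near=> n.
apply: (@squeeze_cvgr _ _ _ _ (fun=> 0) (fun n => K * harmonic n)); last 2 first.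
- exact: cvg_cst.
- by rewrite -(mulr0 K); apply: cvgMl_tmp; exact: cvg_harmonic.
near=> n; rewrite /= A0 /=.
pose c : R := n.+1%:R * (d_avg (y n.+1))^-1.
pose V := Var_BER (P n.+1) (y n.+1).
(* By [bias_identity] the centering is [c] times the mean of [V] minus the true variance; the latter
   cancels and only the fluctuation of [V] remains. *)
have -> : A n = P n.+1 [set z | eps < `|c * (V z - Ex (P n.+1) V)|].
  rewrite /A /=; congr (P n.+1 _); apply/seteqP; split => z /=;
  rewrite subr0 -bias_identity// -mulrBr; congr (_ < `|_ * _|);
  by rewrite opprB addrA subrK.
apply: (le_trans (chebyshev_design _ _ _ eps0)).
rewrite (@Ex_ext _ _ _ _ (fun z => c ^+ 2 * (V z - Ex (P n.+1) V) ^+ 2)); last first.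
  by move=> z; rewrite exprMn.
rewrite ExZ Var_centered /K [X in _ <= X]mulrAC ler_pM2r ?invr_gt0 ?exprn_gt0//.
exact: (@scaled_Var_BER_le _ _ _ _ _ k q).
Unshelve. all: by end_near.
Qed.
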